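(* (a) If $G_1$ and $G_2$ are $A$-cospectral regular graphs, and $H$ is any graph, then $G_1\underline{\vee} H$ and $G_2\underline{\vee} H$ are $A$-cospectral. (b) If $G$ is a regular graph, and $H_1$ and $H_2$ are $A$-cospectral graphs with $\Gamma_{A(H_1)}(x)=\Gamma_{A(H_2)}(x)$, then $G\underline{\vee} H_1$ and $G\underline{\vee} H_2$ are $A$-cospectral.
   Context: All graphs are finite, simple and undirected, with at least one vertex. $A(G)$ is the adjacency matrix of $G$; two graphs are $A$-cospectral if their adjacency matrices have the same spectrum (eigenvalues counted with multiplicity). For an $n\times n$ matrix $M$, the $M$-coronal is the rational function $\Gamma_M(x)=\mathbf{1}_n^T(xI_n-M)^{-1}\mathbf{1}_n$, where $\mathbf{1}_n$ is the all-ones column vector. The subdivision graph $\mathcal{S}(G)$ is obtained from $G$ by inserting a new vertex into every edge of $G$; $I(G)$ denotes the set of inserted vertices. For vertex-disjoint graphs $G,H$, the subdivision-edge join $G\underline{\vee}H$ is the graph obtained from $\mathcal{S}(G)$ and $H$ by joining every vertex of $I(G)$ with every vertex of $V(H)$. *)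

(* Defs.v *)
From HB Require Import structures.
From mathcomp Require Import all_boot all_order all_algebra.

Set Implicit Arguments.
Unset Strict Implicit.
Unset Printing Implicit Defensive.

Import GRing.Theory.
Local Open Scope ring_scope.

Record sgraph := SGraph {
  vertex :> finType;
  adj : rel vertex;
  adj_sym : symmetric adj;
  adj_irrefl : irreflexive adj;
  vertex_gt0 : (0 < #|vertex|)%N
}.

Definition degree (G : sgraph) (x : G) : nat := #|[set y | adj x y]|.

Definition regular (G : sgraph) : Prop := exists r, forall x : G, degree x = r.

Definition edges (G : sgraph) : {set {set G}} :=
  [set e : {set G} | [exists x, exists y, adj x y && (e == [set x; y])]].

Definition edge (G : sgraph) : finType := {e : {set G} | e \in edges G}.

Section Subdivision.
Variable G : sgraph.

Definition subdivision_adj : rel (G + edge G)%type := fun u v =>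
  match u, v with
  | inl x, inr e | inr e, inl x => x \in val e
  | _, _ => false
  end.

Lemma subdivision_sym : symmetric subdivision_adj.
Proof. by case=> u []. Qed.

Lemma subdivision_irrefl : irreflexive subdivision_adj.
Proof. by case. Qed.

Lemma subdivision_gt0 : (0 < #|{: G + edge G}|)%N.
Proof. by rewrite card_sum addn_gt0 vertex_gt0. Qed.

Definition subdivision : sgraph :=
  SGraph subdivision_sym subdivision_irrefl subdivision_gt0.

Definition inserted : {set subdivision} := [set inr e | e : edge G].

End Subdivision.

Section SubdivisionEdgeJoin.
Variables G H : sgraph.

Definition sejoin_adj : rel (subdivision G + H)%type := fun u v =>
  match u, v with
  | inl a, inl b => adj a b
  | inr a, inr b => adj a b
  | inl a, inr _ | inr _, inl a => a \in inserted G
  end.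

Lemma sejoin_sym : symmetric sejoin_adj.
Proof. by case=> u [] v //; apply: (@adj_sym _ u v). Qed.

Lemma sejoin_irrefl : irreflexive sejoin_adj.
Proof. by case=> u; apply: (@adj_irrefl _ u). Qed.

Lemma sejoin_gt0 : (0 < #|{: subdivision G + H}|)%N.
Proof. by rewrite card_sum addn_gt0 vertex_gt0. Qed.

Definition subdivision_edge_join : sgraph :=
  SGraph sejoin_sym sejoin_irrefl sejoin_gt0.

End SubdivisionEdgeJoin.

Definition adjmx (C : nzRingType) (G : sgraph) : 'M[C]_#|G| :=
  \matrix_(i, j) (adj (enum_val i) (enum_val j))%:R.

(* Algebraic multiplicity; it is 0 when x is not an eigenvalue of M. *)
Definition eigen_mult (C : fieldType) n (M : 'M[C]_n) (x : C) : nat :=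
  mup x (char_poly M).

(* Equality of spectra as multisets.  The field C is meant to be algebraically
   closed, so that every eigenvalue of an adjacency matrix lies in C. *)
Definition cospectral (C : fieldType) (G1 G2 : sgraph) : Prop :=
  forall x : C, eigen_mult (adjmx C G1) x = eigen_mult (adjmx C G2) x.

(* The inverse is taken over the field C(x) of rational functions, where
   xI - M is always invertible. *)
Definition coronal (C : fieldType) n (M : 'M[C]_n) : {fraction {poly C}} :=
  ((const_mx 1 : 'rV_n) *m
   invmx ((tofrac 'X)%:M - map_mx (fun a => tofrac a%:P) M) *m
   (const_mx 1 : 'cV_n)) 0 0.

(* Main.v *)
Require Import Defs.
From mathcomp Require Import all_boot all_order all_algebra.
From mathcomp Require Import perm ring.

(* Order the vertices of the join as I(G), V(G), V(H) and work over C(x).  The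
   Schur complement of x - A(H) in x - A(G v H) is

       [ x - g J   -R^T ]
       [  -R         x  ]

   with R the incidence matrix of G, J all ones and g the coronal of A(H); so
   the characteristic polynomial of the join depends on H only through that of
   H and g, which is (b).  If G is r-regular then 1^T R = 2 1^T and
   R R^T = A(G) + r, so det (1 - AB) = det (1 - BA) turns the complement into a
   rank one perturbation of x^2 - r - A(G), along the eigenvector 1 of A(G).
   Its determinant depends only on the spectrum of A(G), on r (the largest
   eigenvalue modulus) and on the numbers n of vertices and n r / 2 of edges,
   which is (a). *)

Set Implicit Arguments.
Unset Strict Implicit.
Unset Printing Implicit Defensive.

Import Order.TTheory GRing.Theory Num.Theory.
Local Open Scope ring_scope.

(** * Determinants: Schur complements and rank one perturbations *)

Section Determinants.

Lemma det_block_schur (R : comUnitRingType) m n (A : 'M[R]_m) (B : 'M_(m, n))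
    (C : 'M_(n, m)) (D : 'M_n) : D \in unitmx ->
  \det (block_mx A B C D) = \det D * \det (A - B *m invmx D *m C).
Proof.
move=> uD; have -> : block_mx A B C D =
    block_mx 1%:M (B *m invmx D) 0 1%:M *m block_mx (A - B *m invmx D *m C) 0 C D.
  by rewrite mulmx_block !(mul1mx, mul0mx, mulmx0, add0r) subrK mulmxKV.
by rewrite det_mulmx det_ublock det_lblock !det1 !mul1r mulrC.
Qed.

(** The block matrix with rows (1, A) and (B, 1) has both sides as its determinant, by eliminating
    one diagonal block or the other. *)
Lemma det_1B_mulmxC (R : comUnitRingType) m n (A : 'M[R]_(m, n)) (B : 'M_(n, m)) :
  \det (1%:M - A *m B) = \det (1%:M - B *m A).
Proof.
have := det_block_schur 1%:M A B (unitmx1 R n).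
rewrite det1 mul1r invmx1 mulmx1 => <-.
have -> : block_mx 1%:M A B 1%:M =
    block_mx 1%:M 0 B 1%:M *m block_mx 1%:M A 0 (1%:M - B *m A).
  by rewrite mulmx_block !(mul1mx, mulmx1, mul0mx, mulmx0, addr0) addrC subrK.
by rewrite det_mulmx det_lblock det_ublock !det1 !mul1r.
Qed.

(** The same permutation acts on rows and columns, so its two signs cancel. *)
Lemma det_mxsub_bij (R : comNzRingType) m n (f : 'I_m -> 'I_n) (A : 'M[R]_n) :
  bijective f -> \det (mxsub f f A) = \det A.
Proof.
move=> bf; have mn : m = n by rewrite -[m]card_ord -[n]card_ord (bij_eq_card bf).
subst n; have fI := bij_inj bf.
have -> : mxsub f f A = row_perm (perm fI) (col_perm (perm fI) A).
  by apply/matrixP=> i j; rewrite !mxE !permE.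
rewrite row_permE col_permE !det_mulmx !det_perm mulrCA -signr_addb.
by rewrite odd_permV addbb mulr1.
Qed.

Lemma horner_char_poly (R : comNzRingType) n (A : 'M[R]_n) (y : R) :
  (char_poly A).[y] = \det (y%:M - A).
Proof.
rewrite -[LHS]/(horner_eval y _) -det_map_mx; congr (\det _).
apply/matrixP=> i j; rewrite !mxE /= /horner_eval hornerD hornerN hornerMn hornerX.
by rewrite hornerC.
Qed.

Lemma mul_row1_col1 (R : pzRingType) n :
  (const_mx 1 : 'rV_n) *m (const_mx 1 : 'cV[R]_n) = n%:R%:M.
Proof.
rewrite [LHS]mx11_scalar; congr (_%:M); rewrite mxE.
by under eq_bigr do rewrite !mxE mulr1; rewrite sumr_const card_ord.
Qed.

Lemma mul_col1_row1 (R : pzRingType) m n :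
  (const_mx 1 : 'cV_m) *m (const_mx 1 : 'rV[R]_n) = const_mx 1.
Proof. by apply/matrixP=> i j; rewrite !mxE big_ord1 !mxE mulr1. Qed.

(** As J = 1 1^T, the product J M J is the number 1^T M 1 times J. This is how the coronal enters
    the Schur complement. *)
Lemma const_mx1_sandwich (R : comPzRingType) p q n (M : 'M[R]_n) :
  const_mx 1 *m M *m const_mx 1 =
  const_mx (((const_mx 1 : 'rV_n) *m M *m (const_mx 1 : 'cV_n)) 0 0) :> 'M_(p, q).
Proof.
rewrite -(mul_col1_row1 R p n) -(mul_col1_row1 R n q) mulmxA.
rewrite -2!(mulmxA (const_mx 1 : 'cV_p)).
set t : 'M_1 := const_mx 1 *m M *m const_mx 1; rewrite {1}[t]mx11_scalar.
rewrite mul_mx_scalar -scalemxAl mul_col1_row1.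
by apply/matrixP => i j; rewrite !mxE mulr1.
Qed.

(** The row 1^T is a left eigenvector of y - A for y - r, so c J = (c / (y - r)) 1 1^T (y - A).
    Pulling y - A out on the right leaves 1 minus a rank one matrix, whose determinant is that of a
    1 by 1 matrix. *)
Lemma det_scalarB_const (F : fieldType) n (A : 'M[F]_n) (y c r : F) :
  y != r -> const_mx 1 *m A = r *: const_mx 1 :> 'rV_n ->
  \det (y%:M - A - const_mx c) = (1 - c * n%:R / (y - r)) * \det (y%:M - A).
Proof.
move=> yr colA; have yr0 : y - r != 0 by rewrite subr_eq0.
set u : 'cV[F]_n := const_mx 1; set v : 'rV[F]_n := const_mx 1.
have vyA : v *m (y%:M - A) = (y - r) *: v.
  by rewrite mulmxBr colA mul_mx_scalar scalerBl.
have -> : y%:M - A - const_mx c =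
    (1%:M - (c / (y - r) *: u) *m v) *m (y%:M - A).
  rewrite mulmxBl mul1mx -mulmxA vyA -scalemxAr -scalemxAl scalerA; congr (_ - _).
  by rewrite mulrC divfK // mul_col1_row1; apply/matrixP=> i j; rewrite !mxE mulr1.
rewrite det_mulmx det_1B_mulmxC -scalemxAr mul_row1_col1 scale_scalar_mx.
rewrite -raddfB det_scalar1; congr ((_ - _) * _); exact: mulrAC.
Qed.

(* [R] plays the role of the incidence matrix of an [r]-regular graph with
   adjacency matrix [A].  As 1^T R = 2 1^T, the term c J is c/4 R^T J R, so the
   Schur complement of the upper left block has the form x - R^T Q R. *)
Lemma det_incidence_block (F : fieldType) n m (R : 'M[F]_(n, m)) (A : 'M_n)
    (r x c : F) :
  2 != 0 :> F -> x != 0 -> x ^+ 2 - r != r ->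
  const_mx 1 *m R = 2 *: const_mx 1 :> 'rV_m ->
  const_mx 1 *m A = r *: const_mx 1 :> 'rV_n ->
  R *m R^T = A + r%:M ->
  \det (block_mx (x%:M - const_mx c) (- R^T) (- R) x%:M) =
  x ^+ (n + m) * x ^- 2 ^+ n * (1 - c * r * x / 2 * n%:R / (x ^+ 2 - r - r))
  * \det ((x ^+ 2 - r)%:M - A).
Proof.
move=> two0 x0 yr colR colA RRT.
have ux : x%:M \in @unitmx F n by rewrite unitmxE det_scalar unitrX ?unitfE.
pose J p q : 'M[F]_(p, q) := const_mx 1.
have JR p : J p n *m R = 2 *: J p m.
  by rewrite /J -(mul_col1_row1 F p n) -mulmxA colR -scalemxAr mul_col1_row1.
have JA p : J p n *m A = r *: J p n.
  by rewrite /J -(mul_col1_row1 F p n) -mulmxA colA -scalemxAr mul_col1_row1.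
have RTJ p : R^T *m J n p = 2 *: J m p.
  by apply: trmx_inj; rewrite trmx_mul trmxK linearZ /= !trmx_const JR.
pose W := x^-1 *: ((c / 4) *: J n n + x^-1%:M) *m R.
have four0 : 4 != 0 :> F by rewrite (natrM F 2 2) mulf_neq0.
have eqm : x%:M - const_mx c - (- R^T) *m invmx x%:M *m (- R)
    = x *: (1%:M - R^T *m W).
  rewrite invmx_scalar mulmxN !mulNmx opprK mul_mx_scalar -scalemxAl.
  rewrite /W -scalemxAl -scalemxAr scalerBr scalerA divff // scale1r.
  rewrite scale_scalar_mx mulr1 mulmxDl mulmxDr mul_scalar_mx -scalemxAl JR.
  rewrite -!scalemxAr RTJ opprD addrA; congr (_ - _ - _).
  by apply/matrixP=> i j; rewrite !mxE; field.
rewrite (det_block_schur _ _ _ ux) eqm detZ det_scalar det_1B_mulmxC.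
(* Since R R^T = A + r and J A = r J, the J part of W R^T is x^-1 (c/4) (2 r) J; extracting x^-2
   turns its coefficient into c r x / 2. *)
have -> : 1%:M - W *m R^T =
    x ^- 2 *: ((x ^+ 2 - r)%:M - A - const_mx (c * r * x / 2)).
  rewrite /W -mulmxA RRT -scalemxAl mulmxDl -scalemxAl mulmxDr JA mul_mx_scalar.
  rewrite mul_scalar_mx; apply/matrixP=> i j; rewrite !mxE.
  by case: (i == j); rewrite ?mulr1n ?mulr0n; field; rewrite ?x0 ?two0 ?four0.
by rewrite detZ (det_scalarB_const _ yr colA) exprD !mulrA.
Qed.

End Determinants.

(** * The incidence matrix of a graph *)

Section Incidence.

Variables (K : nzRingType) (G : sgraph).

Definition incmx : 'M[K]_(#|G|, #|edge G|) :=
  \matrix_(i, j) (enum_val i \in val (enum_val j : edge G))%:R.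

Lemma edgesP (e : {set G}) :
  reflect (exists x y, adj x y /\ e = [set x; y]) (e \in edges G).
Proof.
rewrite inE; apply: (iffP existsP) => [[x /existsP[y /andP[xy /eqP ->]]]|].
  by exists x, y.
by case=> x [y [xy ->]]; exists x; apply/existsP; exists y; rewrite xy /=.
Qed.

Lemma adj_neq (x y : G) : adj x y -> x != y.
Proof. by apply: contraTneq => ->; rewrite adj_irrefl. Qed.

Lemma set2_edge (x y : G) : ([set x; y] \in edges G) = adj x y.
Proof.
apply/edgesP/idP => [[a [b [ab eq_xy]]]|xy]; last by exists x, y.
have abN := adj_neq ab.
have: a \in [set x; y] by rewrite eq_xy set21.
have: b \in [set x; y] by rewrite eq_xy set22.
rewrite !inE => /orP[] /eqP eb /orP[] /eqP ea; rewrite ?ea ?eb ?eqxx // in ab abN.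
by rewrite adj_sym.
Qed.

Lemma card_edge (e : {set G}) : e \in edges G -> #|e| = 2%N.
Proof. by case/edgesP => x [y [xy ->]]; rewrite cards2 adj_neq. Qed.

Lemma edge_set2 (e : {set G}) (x y : G) :
  e \in edges G -> x != y -> x \in e -> y \in e -> e = [set x; y].
Proof.
move=> eE xy xe ye; apply/eqP; rewrite eq_sym eqEcard card_edge // cards2 xy.
by rewrite subUset !sub1set xe ye.
Qed.

(** The neighbours y of x correspond bijectively to the edges {x, y} at x. *)
Lemma card_edges_at (x : G) : #|[set e in edges G | x \in e]| = degree x.
Proof.
rewrite /degree -(card_in_imset (f := fun y => [set x; y])); last first.
  move=> y z; rewrite !inE => xy xz yz.
  have : y \in [set x; z] by rewrite -yz set22.
  by rewrite !inE eq_sym (negPf (adj_neq xy)) => /eqP.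
apply: eq_card => e; rewrite inE; apply/andP/imsetP => [[eE xe]|[y]].
  have [a [b [ab def_e]]] := edgesP _ eE.
  move: xe; rewrite def_e !inE => /orP[]/eqP->; first by exists b; rewrite ?inE.
  by exists a; rewrite ?inE 1?adj_sym // setUC.
by rewrite inE => xy ->; rewrite set2_edge xy set21.
Qed.

Lemma card_edges_at2 (x y : G) : x != y ->
  #|[set e in edges G | (x \in e) && (y \in e)]| = adj x y.
Proof.
move=> xy; case: (boolP (adj x y)) => axy.
  apply/eqP/cards1P; exists [set x; y]; apply/setP => e; rewrite in_set in_set1.
  apply/and3P/eqP => [[eE xe ye]|->]; first exact: edge_set2.
  by rewrite set2_edge !inE !eqxx orbT.
apply/eqP; rewrite cards_eq0; apply/eqP/setP => e; rewrite in_set in_set0.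
apply/and3P => -[eE xe ye]; move: axy.
by rewrite -set2_edge -(edge_set2 eE xy xe ye) eE.
Qed.

Lemma sum_edge (F : {set G} -> K) :
  \sum_(j < #|edge G|) F (val (enum_val j)) = \sum_(e in edges G) F e.
Proof.
transitivity (\sum_(e : edge G) F (val e)); last exact/esym/big_sub.
symmetry; apply: (reindex (enum_val : 'I_#|edge G| -> edge G)).
exact: onW_bij (enum_val_bij _).
Qed.

Lemma row1_incmx : const_mx 1 *m incmx = 2 *: const_mx 1 :> 'rV_#|edge G|.
Proof.
apply/rowP => j; rewrite !mxE mulr1 -(card_edge (valP (enum_val j))).
under eq_bigr do rewrite !mxE mul1r.
rewrite -(big_enum_val (fun x : G => (x \in val (enum_val j))%:R)) /=.
by rewrite -natr_sum -sum1_card -big_mkcond.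
Qed.

(** The entry of R R^T at (x, y) counts the edges containing both vertices: the degree on the
    diagonal, and off it at most one edge, present exactly when x and y are adjacent. *)
Lemma incmx_tr r : (forall x : G, degree x = r) ->
  incmx *m incmx^T = adjmx K G + r%:R%:M.
Proof.
move=> degG; apply/matrixP => i j; rewrite !mxE.
under eq_bigr do rewrite !mxE -natrM mulnb.
set x := enum_val i; set y := enum_val j.
rewrite (sum_edge (fun e => ((x \in e) && (y \in e))%:R)) -natr_sum.
have -> : (\sum_(e in edges G) ((x \in e) && (y \in e)) =
    #|[set e in edges G | (x \in e) && (y \in e)]|)%N.
  by rewrite -sum1dep_card big_mkcondr; apply: eq_bigr => e _; case: ifP.
have [xy|xy] := eqVneq x y.
  under eq_finset do rewrite -xy andbb.
  by rewrite card_edges_at degG xy adj_irrefl (enum_val_inj xy) eqxx add0r.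
rewrite card_edges_at2 //; case: (i =P j) xy => [eq_ij|_ _]; last by rewrite addr0.
by rewrite /x eq_ij eqxx.
Qed.

Lemma row1_adjmx r : (forall x : G, degree x = r) ->
  const_mx 1 *m adjmx K G = r%:R *: const_mx 1 :> 'rV_#|G|.
Proof.
move=> degG; apply/rowP => j; rewrite !mxE mulr1 -(degG (enum_val j)).
under eq_bigr do rewrite !mxE mul1r.
rewrite -(big_enum_val (fun x : G => (adj x (enum_val j))%:R)) /=.
rewrite -natr_sum; congr (_%:R); rewrite /degree -sum1_card [RHS]big_mkcond /=.
by apply: eq_big => // x _; rewrite inE adj_sym; case: adj.
Qed.

End Incidence.

(** * The characteristic polynomial of the join, over C(x) *)

Section CharacteristicPolynomial.

Variable C : fieldType.
Local Notation K := {fraction {poly C}}.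
Local Notation x := (tofrac 'X : K).

Lemma map_adjmx (R S : nzRingType) (f : {rmorphism R -> S}) (G : sgraph) :
  map_mx f (adjmx R G) = adjmx S G.
Proof. by apply/matrixP => i j; rewrite !mxE rmorph_nat. Qed.

Lemma tofrac_char_poly n (M : 'M[C]_n) :
  tofrac (char_poly M) = \det (x%:M - map_mx (fun a => tofrac a%:P) M).
Proof.
rewrite -det_map_mx; congr (\det _); apply/matrixP => i j; rewrite !mxE.
by rewrite rmorphB rmorphMn.
Qed.

Lemma tofrac_char_adjmx (G : sgraph) :
  tofrac (char_poly (adjmx C G)) = \det (x%:M - adjmx K G).
Proof. by rewrite tofrac_char_poly (map_adjmx (@tofrac _ \o polyC)). Qed.

Section Join.

Variables G H : sgraph.

(** Inserted vertices precede V(G), reversing the sum type, so that each Schur complement eliminates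
    a lower right block: first that of V(H), then the scalar block of V(G). *)
Definition sejoin_vertex (i : 'I_(#|edge G| + #|G| + #|H|)) :
    subdivision_edge_join G H :=
  match split i with
  | inl a => inl (match split a with
                  | inl e => inr (enum_val e)
                  | inr v => inl (enum_val v)
                  end)
  | inr h => inr (enum_val h)
  end.

Lemma sejoin_vertex_inj : injective sejoin_vertex.
Proof.
move=> i j; rewrite /sejoin_vertex -{2}(splitK i) -{2}(splitK j).
case: (split i) (split j) => [a|h] [b|h'] //= [].
  rewrite -{2}(splitK a) -{2}(splitK b).
  by case: (split a) (split b) => [e|v] [e'|v'] //= [/enum_val_inj ->].
by move/enum_val_inj->.
Qed.

Lemma sejoin_vertex_bij : bijective sejoin_vertex.
Proof.
apply: inj_card_bij; first exact: sejoin_vertex_inj.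
by rewrite card_ord !card_sum [(#|edge G| + _)%N]addnC.
Qed.

Lemma adjmx_sejoin (R : nzRingType) :
  \matrix_(i, j) (adj (sejoin_vertex i) (sejoin_vertex j))%:R =
  block_mx (block_mx 0 (incmx R G)^T (incmx R G) 0)
    (col_mx (const_mx 1) 0) (row_mx (const_mx 1) 0) (adjmx R H).
Proof.
have ins e : (inr e : subdivision G) \in inserted G by apply/imsetP; exists e.
have insN v : ((inl v : subdivision G) \in inserted G) = false.
  by apply/imsetP => -[].
apply/matrixP => i j; rewrite !mxE /sejoin_vertex.
case: (split i) => [a|h]; rewrite !mxE; case: (split j) => [b|h'] /=;
  rewrite ?mxE //.
- case: (split a) => [e|v]; rewrite ?mxE; case: (split b) => [e'|v'] /=;
    by rewrite ?mxE.
- by case: (split a) => [e|v]; rewrite ?mxE ?ins ?insN.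
- by case: (split b) => [e|v]; rewrite ?mxE ?ins ?insN.
Qed.

(** [adjmx] follows the canonical enumeration of the join; reindexing by [sejoin_vertex] keeps the
    determinant and exposes the blocks. *)
Lemma det_sejoin (R : comNzRingType) (y : R) :
  \det (y%:M - adjmx R (subdivision_edge_join G H)) =
  \det (block_mx (block_mx y%:M (- (incmx R G)^T) (- incmx R G) y%:M)
    (col_mx (- const_mx 1) 0) (row_mx (- const_mx 1) 0) (y%:M - adjmx R H)).
Proof.
have f_bij := bij_comp (enum_rank_bij (subdivision_edge_join G H)) sejoin_vertex_bij.
rewrite -(det_mxsub_bij _ f_bij); congr (\det _).
rewrite raddfB /=.
have -> : mxsub (enum_rank \o sejoin_vertex) (enum_rank \o sejoin_vertex) y%:M
    = block_mx (block_mx y%:M 0 0 y%:M) 0 0 y%:M.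
  rewrite -!scalar_mx_block; apply/matrixP => i j; rewrite !mxE /=.
  by rewrite (inj_eq (bij_inj f_bij)).
have -> : mxsub (enum_rank \o sejoin_vertex) (enum_rank \o sejoin_vertex)
    (adjmx R (subdivision_edge_join G H)) =
    \matrix_(i, j) (adj (sejoin_vertex i) (sejoin_vertex j))%:R.
  by apply/matrixP => i j; rewrite !mxE /= !enum_rankK.
rewrite adjmx_sejoin !(opp_block_mx, opp_col_mx, opp_row_mx) !add_block_mx.
by rewrite !add0r !oppr0 !addr0.
Qed.

(** Only inserted vertices are joined to V(H), so eliminating V(H) changes the I(G) corner alone, by
    the coronal times J. *)
Lemma char_poly_sejoin :
  tofrac (char_poly (adjmx C (subdivision_edge_join G H))) =
  tofrac (char_poly (adjmx C H)) *
  \det (block_mx (x%:M - const_mx (coronal (adjmx C H)))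
    (- (incmx K G)^T) (- incmx K G) x%:M).
Proof.
(* The determinant is a monic polynomial, hence nonzero in C(x). *)
have uH : x%:M - adjmx K H \in unitmx.
  by rewrite unitmxE -tofrac_char_adjmx unitfE tofrac_eq0 monic_neq0 ?char_poly_monic.
rewrite !tofrac_char_adjmx det_sejoin (det_block_schur _ _ _ uH); congr (_ * \det _).
rewrite mul_col_mx mul_col_row !mul0mx !mulmx0 mulmxN !mulNmx opprK.
rewrite opp_block_mx add_block_mx !oppr0 !addr0; congr (block_mx (_ - _) _ _ _).
have -> : coronal (adjmx C H) =
    ((const_mx 1 : 'rV_#|H|) *m invmx (x%:M - adjmx K H)
     *m (const_mx 1 : 'cV_#|H|)) 0 0.
  by rewrite /coronal (map_adjmx (@tofrac _ \o polyC)).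
exact: const_mx1_sandwich.
Qed.

End Join.

End CharacteristicPolynomial.

(** The graph G now enters only through its characteristic polynomial, its degree and its numbers of
    vertices and edges. *)
Lemma char_poly_sejoin_regular (C : fieldType) (G H : sgraph) r :
    2 != 0 :> C -> (forall x : G, degree x = r) ->
  let x : {fraction {poly C}} := tofrac 'X in
  let y := x ^+ 2 - r%:R in
  tofrac (char_poly (adjmx C (subdivision_edge_join G H))) =
  tofrac (char_poly (adjmx C H)) *
  (x ^+ (#|G| + #|edge G|) * x ^- 2 ^+ #|G|
   * (1 - coronal (adjmx C H) * r%:R * x / 2 * #|G|%:R / (y - r%:R))
   * (map_poly (@tofrac _ \o polyC) (char_poly (adjmx C G))).[y]).
Proof.
move=> two0 degG x y; rewrite map_char_poly map_adjmx horner_char_poly.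
rewrite char_poly_sejoin (@det_incidence_block _ _ _ (incmx _ G) (adjmx _ G) r%:R) //.
- by rewrite -(rmorph_nat (@tofrac _ \o polyC)) /= tofrac_eq0 polyC_eq0.
- by rewrite tofrac_eq0 polyX_eq0.
(* The polynomial X^2 is not the constant r + r: their coefficients of degree 2 are 1 and 0. *)
- rewrite subr_eq -!(rmorph_nat (@tofrac _)) -rmorphXn -rmorphD tofrac_eq.
  apply/eqP => /(congr1 (fun p : {poly C} => p`_2)).
  rewrite -natrD coefXn -polyC_natr coefC => /eqP; exact/negP/oner_neq0.
- exact: row1_incmx.
- exact: row1_adjmx.
- exact: incmx_tr.
Qed.

(** * Parameters of a regular graph read off its spectrum *)

(* Both sides are half of 1^T R R^T 1. *)
Lemma sum_degree (G : sgraph) r :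
  (forall x : G, degree x = r) -> (#|edge G| * 2 = #|G| * r)%N.
Proof.
move=> degG; set u : 'rV[int]_#|G| := const_mx 1; set B := incmx int G.
have BBu : u *m B *m (B^T *m u^T) = (2 * r%:R * #|G|%:R)%:M.
  rewrite mulmxA -(mulmxA u) (incmx_tr _ degG) mulmxDr (row1_adjmx _ degG).
  rewrite mul_mx_scalar -scalerDl -scalemxAl trmx_const mul_row1_col1.
  by rewrite scale_scalar_mx -mulr2n -[_ *+ 2]mulr_natl.
have BuB : u *m B *m (B^T *m u^T) = (2 * 2 * #|edge G|%:R)%:M.
  rewrite -trmx_mul row1_incmx linearZ /= -scalemxAl -scalemxAr trmx_const.
  by rewrite mul_row1_col1 !scale_scalar_mx mulrA.
move: BuB; rewrite BBu => /matrixP/(_ 0 0); rewrite !mxE !mulr1n -!mulrA.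
move/(mulfI (isT : (2 : int) != 0)); rewrite -!natrM => /eqP.
by rewrite eqr_nat [(r * _)%N]mulnC [(2 * _)%N]mulnC => /eqP.
Qed.

(* Compare l^1 norms in v A = a v. *)
Lemma eigenvalue_adjmx_le (C : numFieldType) (G : sgraph) r (a : C) :
  (forall x : G, degree x = r) -> root (char_poly (adjmx C G)) a -> `|a| <= r%:R.
Proof.
move=> degG; rewrite -eigenvalue_root_char => /eigenvalueP[v va v0].
have v_gt0 : 0 < \sum_i `|v 0 i|.
  rewrite lt_def sumr_ge0 ?andbT // psumr_eq0 //; apply: contraNN v0.
  move/allP => v0; apply/eqP/rowP => i; apply/eqP; rewrite mxE -normr_eq0.
  exact: v0 (mem_index_enum i).
rewrite -(ler_pM2r v_gt0) mulr_sumr.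
have -> : \sum_i `|a| * `|v 0 i| = \sum_i `|\sum_j v 0 j * adjmx C G j i|.
  apply: eq_bigr => i _; rewrite -normrM; congr `|_|.
  by have /matrixP/(_ 0 i) := va; rewrite !mxE.
apply: le_trans (ler_sum _ (fun i _ => ler_norm_sum _ _ _)) _.
rewrite exchange_big mulr_sumr ler_sum //= => j _.
under eq_bigr do rewrite normrM.
rewrite -mulr_sumr mulrC ler_wpM2r //.
have /matrixP/(_ 0 j) := row1_adjmx C degG.
rewrite !mxE mulr1 => <-; apply: ler_sum => i _.
by rewrite !mxE mul1r normr_nat adj_sym.
Qed.

(** The eigenvector is the all-ones row, nonzero because G has a vertex. With [eigenvalue_adjmx_le],
    the spectrum thus determines r. *)
Lemma degree_eigenvalue (C : fieldType) (G : sgraph) r :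
  (forall x : G, degree x = r) -> root (char_poly (adjmx C G)) r%:R.
Proof.
move=> degG; rewrite -eigenvalue_root_char; apply/eigenvalueP.
exists (const_mx 1); first exact: row1_adjmx.
apply: contraTneq (vertex_gt0 G) => /matrixP v0.
rewrite -eqn0Ngt; case: posnP => // G0.
by have /eqP := v0 0 (Ordinal G0); rewrite !mxE oner_eq0.
Qed.

(** Both polynomials are monic and split, and equal multiplicities make their lists of roots
    permutations of each other. *)
Lemma cospectral_char_poly (C : closedFieldType) (G1 G2 : sgraph) :
  cospectral C G1 G2 -> char_poly (adjmx C G1) = char_poly (adjmx C G2).
Proof.
move=> cosp.
have [s1] := closed_field_poly_normal (char_poly (adjmx C G1)).
have [s2] := closed_field_poly_normal (char_poly (adjmx C G2)).
rewrite !(monicP (char_poly_monic _)) !scale1r => e2 e1.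
rewrite e1 e2; apply: perm_big; apply/allP => z _ /=; apply/eqP.
by rewrite -!mu_prod_XsubC -e1 -e2; apply: cosp.
Qed.

Theorem corollary3p4 (C : numClosedFieldType) :
  (forall G1 G2 H : sgraph,
      cospectral C G1 G2 -> regular G1 -> regular G2 ->
      cospectral C (subdivision_edge_join G1 H) (subdivision_edge_join G2 H))
  /\
  (forall G H1 H2 : sgraph,
      regular G -> cospectral C H1 H2 ->
      coronal (adjmx C H1) = coronal (adjmx C H2) ->
      cospectral C (subdivision_edge_join G H1) (subdivision_edge_join G H2)).
Proof.
(* In both parts it suffices that the two characteristic polynomials agree, which is checked after
   embedding them in C(x). *)
split=> [G1 G2 H /cospectral_char_poly cosp [r1 deg1] [r2 deg2]
        |G H1 H2 _ /cospectral_char_poly cosp cor] z;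
  congr (mup z _); apply/eqP; rewrite -tofrac_eq; apply/eqP; last first.
  by rewrite !char_poly_sejoin cosp cor.
have two0 : 2 != 0 :> C by rewrite pnatr_eq0.
have cardG : #|G1| = #|G2|.
  by apply: succn_inj; rewrite -(size_char_poly (adjmx C G1)) cosp size_char_poly.
(* Each degree is an eigenvalue of the other graph by cospectrality, hence bounded by the other
   degree. *)
have r12 : r1 = r2.
  apply/eqP; rewrite eqn_leq -!(ler_nat C) -[X in (X <= r2%:R) && _]normr_nat.
  rewrite -[X in _ && (X <= _)]normr_nat.
  rewrite (eigenvalue_adjmx_le deg2) ?(eigenvalue_adjmx_le deg1) //.
    by rewrite cosp degree_eigenvalue.
  by rewrite -cosp degree_eigenvalue.
subst r2; have edgeG : #|edge G1| = #|edge G2|.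
  apply/eqP; rewrite -(eqn_pmul2r (m := 2)) //.
  by rewrite (sum_degree deg1) (sum_degree deg2) cardG.
rewrite (char_poly_sejoin_regular H two0 deg1) (char_poly_sejoin_regular H two0 deg2).
by rewrite cosp cardG edgeG.
Qed.
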